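(* Let $f$ be a symmetric nontrivial tradeoff function. Let $N\sim F$ be a canonical noise distribution (CND) for $f$, and let $N'$ be a real-valued random variable such that $T(N',N'+1)\geq f$. Then for every integer $t\geq 0$, $$P(|N|\leq t/2)\geq\sup_{a\in\mathbb{R}}P\left(-t/2<N'-a\leq t/2\right).$$
   Context: For probability distributions $P,Q$ on a common measurable space, the tradeoff function $T(P,Q):[0,1]\to[0,1]$ is $T(P,Q)(\alpha)=\inf\{1-\mathbb{E}_Q(\phi)\mid \mathbb{E}_P(\phi)\leq 1-\alpha\}$, the infimum over measurable tests $\phi$ with values in $[0,1]$. For random variables $X,Y$, $T(X,Y)$ denotes the tradeoff function of their laws. A function $f:[0,1]\to[0,1]$ is a tradeoff function if $f=T(P,Q)$ for some $P,Q$; equivalently, $f$ is convex, continuous, non-decreasing, and $f(x)\leq x$ for all $x\in[0,1]$. It is nontrivial if $f(\alpha)<\alpha$ for some $\alpha\in(0,1)$, and symmetric if $f=T(P,Q)$ implies $f=T(Q,P)$. Inequalities between functions are pointwise. Canonical noise distribution: let $f$ be a symmetric tradeoff function and $N$ a continuous real random variable (continuous cdf) with cdf $F$. Then $F$ (or $N$) is a canonical noise distribution (CND) for $f$ if (1) $T(N,N+m)\geq f$ for all $m\in[0,1]$; (2) $f(\alpha)=T(N,N+1)(\alpha)$ for all $\alpha\in(0,1)$; (3) $T(N,N+1)(\alpha)=F(F^{-1}(\alpha)-1)$ for all $\alpha\in(0,1)$, where $F^{-1}$ is the quantile function; (4) $F(x)=1-F(-x)$ for all $x\in\mathbb{R}$.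 *)

(* Defs.v *)
From HB Require Import structures.
From mathcomp Require Import all_boot all_order all_algebra.
From mathcomp Require Import all_classical all_reals all_analysis.
From mathcomp Require Import measurable_realfun.
Set Implicit Arguments.
Unset Strict Implicit.
Unset Printing Implicit Defensive.
Import Order.TTheory GRing.Theory Num.Theory.
Import numFieldNormedType.Exports.
Local Open Scope classical_set_scope.
Local Open Scope ring_scope.

(* A function [0,1] -> [0,1] is represented by a
   total function R -> R of which only the values on [0,1] are ever used. *)

Definition is_test {R : realType} {d : measure_display} {T : measurableType d}
    (phi : {mfun T >-> R}) : Prop :=
  forall x, 0 <= phi x <= 1.

Definition tradeoff {R : realType} {d : measure_display}
    {T : measurableType d} (P Q : probability T R) (alpha : R) : R :=
  inf [set 1 - fine 'E_Q[phi] | phi in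
        [set phi : {mfun T >-> R} |
          is_test phi /\ ('E_P[phi] <= (1 - alpha)%:E)%E]].

Definition tradeoffRV {R : realType} {d d' : measure_display}
    {T : measurableType d} {T' : measurableType d'}
    {P : probability T R} {P' : probability T' R}
    (X : {RV P >-> R}) (Y : {RV P' >-> R}) : R -> R :=
  tradeoff (distribution P X) (distribution P' Y).

Definition is_tradeoff {R : realType} (f : R -> R) : Prop :=
  exists (d : measure_display) (T : measurableType d) (P Q : probability T R),
    {in `[0, 1], f =1 tradeoff P Q}.

Definition nontrivial_tradeoff {R : realType} (f : R -> R) : Prop :=
  exists2 alpha : R, alpha \in `]0, 1[ & f alpha < alpha.

Definition symmetric_tradeoff {R : realType} (f : R -> R) : Prop :=
  forall (d : measure_display) (T : measurableType d) (P Q : probability T R),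
    {in `[0, 1], f =1 tradeoff P Q} -> {in `[0, 1], f =1 tradeoff Q P}.

Definition shiftRV {R : realType} {d : measure_display} {T : measurableType d}
    {P : probability T R} (X : {RV P >-> R}) (m : R) : {RV P >-> R} :=
  (X : {mfun T >-> R}) \+ cst m.

Definition rcdf {R : realType} {d : measure_display} {T : measurableType d}
    {P : probability T R} (X : {RV P >-> R}) (x : R) : R := fine (cdf X x).

(* The infimum is that of a nonempty set bounded below, hence meaningful,
   only for 0 < alpha < 1. *)
Definition quantile {R : realType} (F : R -> R) (alpha : R) : R :=
  inf [set x | alpha <= F x].

Definition is_CND {R : realType} {d : measure_display} {T : measurableType d}
    {P : probability T R} (f : R -> R) (N : {RV P >-> R}) : Prop :=
  let F := rcdf N in
  [/\ continuous F,
      forall m alpha : R, m \in `[0, 1] -> alpha \in `[0, 1] ->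
        f alpha <= tradeoffRV N (shiftRV N m) alpha,
      {in `]0, 1[, f =1 tradeoffRV N (shiftRV N 1)},
      {in `]0, 1[, forall alpha,
        tradeoffRV N (shiftRV N 1) alpha = F (quantile F alpha - 1)}
    & forall x, F x = 1 - F (- x)].

(* Main.v *)
(* Write F and G for the cdfs of N and N'. Half-line tests give
   f (G z) <= G (z - 1), and the CND axioms give F (y - 1) = f (F y) whenever
   F y < 1. Iterating, F y = G z implies F (y - t) <= G (z - t), so a window
   ]z - t, z] of N' is no heavier than the window ]y - t, y] of N. The latter
   has mass q - f^t(q) with q = F y, a concave function of q since the
   t-th iterate f^t is convex; the symmetry of F makes it invariant under
   q |-> 1 - f^t(q), whose fixed point q = F (t / 2), the centred window, is
   therefore a maximum. *)
Require Import Defs.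
From HB Require Import structures.
From mathcomp Require Import all_boot all_order all_algebra.
From mathcomp Require Import all_classical all_reals all_analysis.
From mathcomp Require Import measurable_realfun.
From mathcomp Require Import ring lra.
Set Implicit Arguments.
Unset Strict Implicit.
Unset Printing Implicit Defensive.
Import Order.TTheory GRing.Theory Num.Theory.
Import numFieldNormedType.Exports.
Local Open Scope classical_set_scope.
Local Open Scope ring_scope.

(** * Tests and the convexity of tradeoff functions *)

Section tradeoff_theory.
Context {R : realType} {d : measure_display} {T : measurableType d}.
Implicit Types (P Q : probability T R) (phi : {mfun T >-> R}).

Lemma test_Lfun P phi : is_test phi -> (phi : T -> R) \in Lfun P 1.
Proof.
move=> phi01; apply/Lfun1_integrable; apply: measurable_bounded_integrable => //.
  by rewrite (le_lt_trans (probability_le1 _ _))// ltry.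
exists 1; split => // M M1 x _; have /andP[p0 p1] := phi01 x.
by rewrite /= ger0_norm// (le_trans p1)// ltW.
Qed.

Lemma expectation_test_fin_num P phi :
  is_test phi -> 'E_P[phi]%E \is a fin_num.
Proof. by move=> phi01; apply: expectation_fin_num; exact: test_Lfun. Qed.

Lemma expectation_test P phi : is_test phi -> 0 <= fine 'E_P[phi]%E <= 1.
Proof.
move=> phi01; rewrite -!lee_fin fineK ?expectation_test_fin_num//.
rewrite expectation_ge0/=; last by move=> x; have /andP[] := phi01 x.
rewrite -(expectation_cst P 1); apply: expectation_le => //=.
- by move=> x; have /andP[] := phi01 x.
- by apply: aeW => x; have /andP[] := phi01 x.
Qed.

Lemma tradeoff_has_lbound P Q alpha : has_lbound
  [set 1 - fine 'E_Q[phi] | phi in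
    [set phi : {mfun T >-> R} |
      is_test phi /\ ('E_P[phi] <= (1 - alpha)%:E)%E]].
Proof.
exists 0 => _ [phi [phi01 _] <-].
by have /andP[_] := expectation_test Q phi01; rewrite subr_ge0.
Qed.

Lemma tradeoff_le P Q alpha phi : is_test phi ->
  ('E_P[phi] <= (1 - alpha)%:E)%E -> tradeoff P Q alpha <= 1 - fine 'E_Q[phi]%E.
Proof.
move=> phi01 phia; apply: ge_inf; first exact: tradeoff_has_lbound.
by exists phi.
Qed.

Lemma tradeoff_set_nonempty P Q alpha : alpha <= 1 ->
  [set 1 - fine 'E_Q[phi] | phi in
    [set phi : {mfun T >-> R} |
      is_test phi /\ ('E_P[phi] <= (1 - alpha)%:E)%E]] !=set0.
Proof.
move=> a1; exists (1 - fine 'E_Q[cst 0%R]), (cst 0) => //; split.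
  by move=> x /=; rewrite lexx ler01.
by rewrite /= expectation_cst lee_fin subr_ge0.
Qed.

Lemma tradeoff_ge0 P Q alpha : alpha <= 1 -> 0 <= tradeoff P Q alpha.
Proof.
move=> a1; apply: lb_le_inf; first exact: tradeoff_set_nonempty.
move=> _ [phi [phi01 _] <-].
by have /andP[_] := expectation_test Q phi01; rewrite subr_ge0.
Qed.

(** The witness is the constant test [1 - alpha], which ignores the observation. *)
Lemma tradeoff_le_id P Q alpha : 0 <= alpha <= 1 -> tradeoff P Q alpha <= alpha.
Proof.
move=> /andP[a0 a1]; have := @tradeoff_le P Q alpha (cst (1 - alpha)).
rewrite !expectation_cst/= subKr lexx; apply => // x /=.
by rewrite subr_ge0 a1 gerBl.
Qed.

(** Expectation is linear, so mixing a near-optimal test at level [a] with one at level [b] gives an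
    admissible test at the mixed level. The slack [e] replaces optimal tests. *)
Lemma tradeoff_convex P Q :
  convex_function (`[0, 1] : set (convex_lmodType R^o)) (tradeoff P Q).
Proof.
move=> l a b; rewrite !inE/= !in_itv/= => /andP[a0 a1] /andP[b0 b1].
rewrite [X in tradeoff _ _ X]convRE convRE.
have k0 : 0 <= l%:num by [].
have k1 : l%:num <= 1 by [].
set k := l%:num in k0 k1 *.
apply/ler_addgt0Pr => e e0.
have [_ [phi [phi01 phia] <-] ltphi] := inf_adherent e0
  (conj (tradeoff_set_nonempty P Q a1) (tradeoff_has_lbound P Q a)).
have [_ [psi [psi01 psib] <-] ltpsi] := inf_adherent e0
  (conj (tradeoff_set_nonempty P Q b1) (tradeoff_has_lbound P Q b)).
rewrite -/(tradeoff P Q a) in ltphi; rewrite -/(tradeoff P Q b) in ltpsi.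
pose chi : {mfun T >-> R} := (k \o* phi) \+ ((1 - k) \o* psi).
have chi01 : is_test chi.
  move=> x /=; have /andP[? ?] := phi01 x; have /andP[? ?] := psi01 x.
  by apply/andP; split; nra.
have Echi S : 'E_S[chi]%E =
    (k * fine 'E_S[phi]%E + (1 - k) * fine 'E_S[psi]%E)%:E.
  rewrite /chi expectationD ?Lfun_scale ?test_Lfun//.
  rewrite !expectationZl ?test_Lfun//.
  rewrite -[in LHS](fineK (expectation_test_fin_num S phi01)).
  by rewrite -[in LHS](fineK (expectation_test_fin_num S psi01)).
rewrite -(fineK (expectation_test_fin_num P phi01)) lee_fin in phia.
rewrite -(fineK (expectation_test_fin_num P psi01)) lee_fin in psib.
have := @tradeoff_le P Q (k * a + (1 - k) * b) chi chi01.
rewrite !Echi lee_fin/= => H.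
apply: (le_trans (H _)); first nra.
by rewrite /unstable.onem; nra.
Qed.

End tradeoff_theory.

(** * Convex functions on the unit interval and their iterates *)

Section unit_interval_convexity.
Context {R : realType}.
Local Notation convex01 :=
  (convex_function (`[0, 1] : set (convex_lmodType R^o))).
Implicit Types (f : R -> R).

Lemma convex01_le f (l a b : R) : convex01 f -> 0 <= l <= 1 ->
  0 <= a <= 1 -> 0 <= b <= 1 ->
  f (l * a + (1 - l) * b) <= l * f a + (1 - l) * f b.
Proof.
move=> cf /andP[l0 l1] a01 b01.
by have := cf (Itv01 l0 l1) a b; rewrite !inE/= !in_itv/= !convRE; apply.
Qed.

(** The chord from the origin to [b] gives [f a <= a / b * f b], and [a / b <= 1]. *)
Lemma convex01_nondecreasing f (a b : R) : convex01 f -> f 0 = 0 ->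
  (forall x, 0 <= x <= 1 -> 0 <= f x) ->
  0 <= a -> a <= b -> b <= 1 -> f a <= f b.
Proof.
move=> cf f0 fge0 a0 ab b1; have [b0|b0] := leP b 0.
  by have -> : a = b by lra.
have ab01 : 0 <= a / b <= 1 by rewrite divr_ge0 ?ler_pdivrMr ?mul1r// ltW.
have b01 : 0 <= b <= 1 by rewrite (ltW b0).
have fab : f a <= a / b * f b.
  have : f (a / b * b + (1 - a / b) * 0) <= a / b * f b + (1 - a / b) * f 0.
    by apply: convex01_le; rewrite ?lexx ?ler01.
  by rewrite f0 !mulr0 !addr0 divfK ?gt_eqF.
have : 0 <= f b by exact: fge0.
by case/andP: ab01; nra.
Qed.

Lemma iter_unit_interval f n (x : R) :
  (forall y, 0 <= y <= 1 -> 0 <= f y <= 1) -> 0 <= x <= 1 ->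
  0 <= iter n f x <= 1.
Proof. by move=> f01 x01; elim: n => //= n; exact: f01. Qed.

(** Composing a convex function with a nondecreasing convex one preserves convexity; [f] is
    nondecreasing because it is convex, nonnegative and zero at 0. *)
Lemma convex01_iter f n : (forall x, 0 <= x <= 1 -> 0 <= f x <= 1) ->
  f 0 = 0 -> convex01 f -> convex01 (iter n f).
Proof.
move=> f01 f0 cf; elim: n => [|n IHn] l a b a01 b01 //=.
have n01 x : 0 <= x <= 1 -> 0 <= iter n f x <= 1 by exact: iter_unit_interval.
have := IHn l a b a01 b01; move: a01 b01.
rewrite !inE/= !in_itv/= !convRE => a01 b01 IH.
have l0 : 0 <= l%:num by []. have l1 : l%:num <= 1 by [].
have l01 : 0 <= l%:num <= 1 by rewrite l0.
apply: le_trans (convex01_le cf l01 (n01 _ a01) (n01 _ b01)).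
have /andP[na0 na1] := n01 _ a01; have /andP[nb0 nb1] := n01 _ b01.
case/andP: a01 => a0 a1; case/andP: b01 => b0 b1.
apply: convex01_nondecreasing => //.
- by move=> x /f01/andP[].
- have /n01/andP[] // : 0 <= l%:num * a + (1 - l%:num) * b <= 1.
  by apply/andP; split; nra.
- by set k := l%:num in l0 l1 *; nra.
Qed.

(** If [f a] were below [c], then so would be the start of a chord leaving [a] to the right, and [f]
    lies under that chord. This replaces right-continuity of [f] at [a]. *)
Lemma convex01_right_le f (a c : R) : convex01 f -> 0 <= a < 1 ->
  (forall x, a < x < 1 -> c <= f x) -> c <= f a.
Proof.
move=> cf /andP[a0 a1] cle; rewrite leNgt; apply/negP => fac.
pose b := (a + 1) / 2.
have cfb : c <= f b by apply: cle; rewrite /b; apply/andP; split; lra.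
have fb0 : 0 < f b - f a by lra.
(* At this weight the chord from [a] to [b] is at height [(c + f a) / 2]. *)
pose l := 1 - (c - f a) / (2 * (f b - f a)).
have lE : (1 - l) * (f b - f a) = (c - f a) / 2.
  by rewrite /l; field; rewrite gt_eqF.
have l01 : 0 <= l < 1.
  have : 0 < (1 - l) * (f b - f a) <= (f b - f a) / 2.
    by rewrite lE; apply/andP; split; lra.
  by move=> /andP[? ?]; apply/andP; split; nra.
case/andP: l01 => l0 l1.
have : c <= f (l * a + (1 - l) * b).
  by apply: cle; rewrite /b; apply/andP; split; nra.
have : f (l * a + (1 - l) * b) <= l * f a + (1 - l) * f b.
  by apply: convex01_le => //; rewrite /b; apply/andP; split; lra.
nra.
Qed.

End unit_interval_convexity.

(** * Real-valued cdfs, windows and half-line tests *)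

Section rcdf_theory.
Context {R : realType} {d : measure_display} {T : measurableType d}.
Context {P : probability T R} (X : {RV P >-> R}).
Local Notation F := (rcdf X).

Lemma rcdfE x : cdf X x = (F x)%:E.
Proof. by rewrite fineK// fin_num_measure. Qed.

Lemma rcdf_ge0 x : 0 <= F x.
Proof. by rewrite -lee_fin -rcdfE cdf_ge0. Qed.

Lemma rcdf_le1 x : F x <= 1.
Proof. by rewrite -lee_fin -rcdfE cdf_le1. Qed.

Lemma rcdf_unit x : 0 <= F x <= 1.
Proof. by rewrite rcdf_ge0 rcdf_le1. Qed.

Lemma rcdf_nondecreasing : {homo F : x y / x <= y}.
Proof. by move=> x y xy; rewrite -lee_fin -!rcdfE cdf_nondecreasing. Qed.

Lemma rcdf_lt_inv x y : F x < F y -> x < y.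
Proof.
by move=> xy; rewrite ltNge; apply/negP => /rcdf_nondecreasing; rewrite leNgt xy.
Qed.

Lemma cvg_rcdfy1 : F @ +oo --> (1 : R).
Proof. exact/fine_cvg/cvg_cdfy1. Qed.

Lemma cvg_rcdfNy0 : F @ -oo --> (0 : R).
Proof. exact/fine_cvg/cvg_cdfNy0. Qed.

(** Intermediate values between the two tails. The levels 0 and 1 are excluded, as they may be only
    limits. *)
Lemma rcdf_attains q : continuous F -> 0 < q < 1 -> exists y, F y = q.
Proof.
move=> cF /andP[q0 q1].
have [a Fa] := filter_ex (cvgr_lt _ cvg_rcdfNy0 _ q0).
have [b Fb] := filter_ex (cvgr_gt _ cvg_rcdfy1 _ q1).
have ab : a <= b.
  by apply/ltW/rcdf_lt_inv; lra.
have [] := @IVT R F a b q ab.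
- exact: continuous_subspaceT.
- by rewrite ge_min (ltW Fa) le_max (ltW Fb) orbT.
- by move=> y _; exists y.
Qed.

Lemma probability_itv_rcdf a b : a <= b ->
  P [set w | (a < X w <= b)%R] = (F b - F a)%:E.
Proof.
move=> ab; rewrite EFinB -!rcdfE /cdf.
have -> : [set w | (a < X w <= b)%R] = X @^-1` `]a, b].
  by apply/seteqP; split => w /=; rewrite in_itv.
rewrite -[P _]/(distribution P X _).
have -> : `]a, b]%classic = `]-oo, b] `\` `]-oo, a].
  apply/seteqP; split => x /=; rewrite !in_itv/=.
    by move=> /andP[ax xb]; split=> //; apply/negP; rewrite -ltNge.
  by move=> [xb /negP]; rewrite -ltNge => ->.
rewrite measureD//; last by rewrite (le_lt_trans (probability_le1 _ _))// ltry.
congr (_ - distribution P X _)%E.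
apply/setIidPr => x /=; rewrite !in_itv/= => xa; exact: le_trans ab.
Qed.

Lemma rcdf_shift m z : rcdf (shiftRV X m) z = F (z - m).
Proof.
rewrite /rcdf /cdf /distribution /pushforward; congr (fine (P _)).
by apply/seteqP; split => w /=; rewrite !in_itv/= lerBrDr.
Qed.

(** The indicator of []z, +oo[] is a test with expectation [1 - F z] under [X] and [1 - F (z - m)]
    under the shifted variable. *)
Lemma tradeoffRV_shift_le m z alpha : alpha <= F z ->
  tradeoffRV X (shiftRV X m) alpha <= F (z - m).
Proof.
move=> az; have mz : measurable (`]z, +oo[ : set R) by exact: measurable_itv.
have ccdfE (Y : {RV P >-> R}) : ccdf Y z = (1 - rcdf Y z)%:E.
  have := cdf_ccdf_1 Y z; have -> : cdf Y z = (rcdf Y z)%:E.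
    by rewrite fineK// fin_num_measure.
  case: (ccdf Y z) => [r||]//=; rewrite -EFinD => -[] <-.
  by rewrite addrC addKr.
have E (Y : {RV P >-> R}) :
    'E_(distribution P Y)[indic_mfun _ mz]%E = (1 - rcdf Y z)%:E.
  by rewrite -ccdfE; exact: expectation_indic.
have := @tradeoff_le _ _ _ (distribution P X)
  (distribution P (shiftRV X m)) alpha (indic_mfun _ mz).
rewrite !E rcdf_shift lee_fin/= subKr; apply; last by rewrite lerB.
by move=> x; rewrite /= mindicE ler0n lern1 leq_b1.
Qed.

End rcdf_theory.

(** * Unit shifts of a canonical noise distribution as iterates of [f] *)

Section cnd_window.
Context {R : realType} {f : R -> R}.
Context {d : measure_display} {T : measurableType d} {P : probability T R}.
Context {N : {RV P >-> R}}.
Hypotheses (f_tradeoff : is_tradeoff f) (N_CND : is_CND f N).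
Local Notation F := (rcdf N).

Lemma is_tradeoff_convex :
  convex_function (`[0, 1] : set (convex_lmodType R^o)) f.
Proof.
have [d0 [T0 [P0 [Q0 fE]]]] := f_tradeoff.
move=> l a b a01 b01; have := tradeoff_convex P0 Q0 l a01 b01.
move: a01 b01; rewrite !inE/= !convRE => a01 b01.
rewrite !fE//; move: a01 b01; rewrite !in_itv/= => /andP[a0 a1] /andP[b0 b1].
have l0 : 0 <= l%:num by []. have l1 : l%:num <= 1 by [].
change (0 <= l%:num * a + (1 - l%:num) * b <= 1); set k := l%:num in l0 l1 *.
by apply/andP; split; nra.
Qed.

Lemma is_tradeoff_itv x : 0 <= x <= 1 -> 0 <= f x <= x.
Proof.
have [d0 [T0 [P0 [Q0 fE]]]] := f_tradeoff.
move=> x01; rewrite fE ?in_itv//= tradeoff_le_id//.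
by case/andP: x01 => _ x1; rewrite tradeoff_ge0.
Qed.

Lemma is_tradeoff_unit x : 0 <= x <= 1 -> 0 <= f x <= 1.
Proof.
move=> x01; have /andP[-> fx] := is_tradeoff_itv x01.
by case/andP: x01 => _; exact: le_trans.
Qed.

Lemma is_tradeoff0 : f 0 = 0.
Proof. by apply/eqP; rewrite eq_le andbC is_tradeoff_itv// lexx ler01. Qed.

Lemma rcdf_pred_eq0 y : F y <= 0 -> F (y - 1) = 0.
Proof.
move=> Fy; apply/eqP; rewrite eq_le rcdf_ge0 andbT (le_trans _ Fy)//.
by apply: rcdf_nondecreasing; rewrite gerBl.
Qed.

(** The half-line test gives [f (F y) <= F (y - 1)]. Conversely, every level [x] above [F y] has its
    quantile at or right of [y], so [f x >= F (y - 1)], and convexity carries this bound down to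
    [F y]. When [F y = 1] there are no such levels, and [F (y - 1)] may then vary with [y]. *)
Lemma CND_rcdf_pred y : F y < 1 -> F (y - 1) = f (F y).
Proof.
move=> Fy1; have [cF fle fE qE _] := N_CND.
have [Fy0|Fy0] := leP (F y) 0.
  have -> : F y = 0 by apply/eqP; rewrite eq_le Fy0 rcdf_ge0.
  by rewrite is_tradeoff0 rcdf_pred_eq0.
apply/eqP; rewrite eq_le; apply/andP; split; last first.
  apply: le_trans (tradeoffRV_shift_le 1 (lexx (F y))).
  by apply: fle; rewrite in_itv/= ?ler01 ?lexx ?rcdf_unit.
(* [F] may be flat to the right of [y], so [y] need not be the quantile of
   [F y]; the quantiles of larger levels do lie to the right of [y]. *)
apply: (convex01_right_le is_tradeoff_convex); first by rewrite rcdf_ge0.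
move=> x /andP[Fyx x1].
have x01 : x \in `]0, 1[ by rewrite in_itv/= x1 (lt_trans Fy0).
rewrite fE// qE//; apply: rcdf_nondecreasing; rewrite lerB//.
have [z Fz] : exists z, F z = x by apply: rcdf_attains; rewrite -?in_itv.
apply: lb_le_inf; first by exists z; rewrite /= Fz.
by move=> w /= xw; exact/ltW/(rcdf_lt_inv (X := N))/(lt_le_trans Fyx).
Qed.

Lemma rcdf_ltB1 y n : F y < 1 -> F (y - n%:R) < 1.
Proof. by apply/le_lt_trans/rcdf_nondecreasing; rewrite gerBl. Qed.

Lemma CND_rcdf_iter y n : F y < 1 -> F (y - n%:R) = iter n f (F y).
Proof.
move=> Fy1; elim: n => [|n IHn]; first by rewrite subr0.
by rewrite iterS -IHn -CND_rcdf_pred ?rcdf_ltB1// -natr1 opprD addrA.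
Qed.

(** * Comparison of the cdfs of [N] and [N'] along unit shifts *)

Section comparison.
Context {d' : measure_display} {T' : measurableType d'}.
Context {P' : probability T' R} (N' : {RV P' >-> R}).
Hypothesis N'_f : forall alpha : R, alpha \in `[0, 1] ->
  f alpha <= tradeoffRV N' (shiftRV N' 1) alpha.

(** One step left applies [f] exactly for [N], while for [N'] the half-line test at [z - n%:R] gives
    at least [f] of any level not above the cdf there. *)
Lemma CND_rcdf_shift_le y z n : F y < 1 -> F y <= rcdf N' z ->
  F (y - n%:R) <= rcdf N' (z - n%:R).
Proof.
move=> Fy1 Fyz; elim: n => [|n IHn]; first by rewrite !subr0.
rewrite -natr1 !opprD !addrA CND_rcdf_pred ?rcdf_ltB1//.
apply: le_trans (tradeoffRV_shift_le 1 IHn).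
by apply: N'_f; rewrite in_itv/= rcdf_unit.
Qed.

End comparison.

(** * Maximality of the centred window *)

Variable t : nat.
Local Notation h := (t%:R / 2 : R).
Local Notation M y := (F y - F (y - t%:R)).

Lemma CND_rcdfN x : F (- x) = 1 - F x.
Proof. by have [_ _ _ _ ->] := N_CND; rewrite opprK. Qed.

(** Reflection in the origin exchanges the two ends of the window. *)
Lemma windowN y : M (t%:R - y) = M y.
Proof.
have -> : t%:R - y - t%:R = - y by ring.
by rewrite -[t%:R - y]opprB !CND_rcdfN; ring.
Qed.

Lemma window_half : M h = 2 * F h - 1.
Proof.
have -> : h - t%:R = - h by lra.
by rewrite CND_rcdfN; ring.
Qed.

(** Write p, q, s for [F] at [v], [h], [t%:R - v]. Positivity of [F (v - t%:R)] means s < 1, so the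
    [t]-th iterate of [f] sends p, q, s to 1 - s, 1 - q, 1 - p. Convexity at q, which lies between p
    and s, yields p + s <= 2q, and the two windows have masses p + s - 1 and 2q - 1. *)
Lemma window_le_half_pos v : F h < 1 -> v <= h -> 0 < F (v - t%:R) ->
  M v <= M h.
Proof.
move=> Fh1 vh Fv0; rewrite window_half.
have h01 : F (t%:R - v) < 1 by rewrite -[_ - v]opprB CND_rcdfN; lra.
have Fvh : F v <= F h by exact: rcdf_nondecreasing.
have Fhs : F h <= F (t%:R - v) by apply: rcdf_nondecreasing; lra.
have kv := CND_rcdf_iter t (le_lt_trans Fvh Fh1).
have kh := CND_rcdf_iter t Fh1.
have ks := CND_rcdf_iter t h01.
have ck := convex01_iter t is_tradeoff_unit is_tradeoff0 is_tradeoff_convex.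
have Es : F (v - t%:R) = 1 - F (t%:R - v) by rewrite -CND_rcdfN opprB.
have Ev : F (t%:R - v - t%:R) = 1 - F v by rewrite -CND_rcdfN; congr F; ring.
have Eh : F (h - t%:R) = 1 - F h by rewrite -CND_rcdfN; congr F; lra.
rewrite Ev in ks; rewrite Eh in kh.
(* In the first case the three values coincide; the other makes the denominator of [l] positive. *)
have [sv|sv] := leP (F (t%:R - v)) (F v); first by lra.
pose l := (F (t%:R - v) - F h) / (F (t%:R - v) - F v).
have lE : l * F v + (1 - l) * F (t%:R - v) = F h.
  by rewrite /l; field; lra.
have l01 : 0 <= l <= 1.
  apply/andP; split; first by apply: divr_ge0; lra.
  by rewrite ler_pdivrMr ?subr_gt0// mul1r; lra.
have := convex01_le ck l01 (rcdf_unit N v) (rcdf_unit N (t%:R - v)).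
rewrite lE -kv -kh -ks Es; lra.
Qed.

Lemma window_le_half v : M v <= M h.
Proof.
(* The reflection of [windowN] exchanges the two sides of [h]. *)
wlog vh : v / v <= h => [wl|].
  have [|hv] := leP v h; first exact: wl.
  by rewrite -windowN; apply: wl; lra.
(* If [F h = 1], the centred window carries all the mass. *)
have [Fh1|Fh1] := leP 1 (F h).
  by rewrite window_half; have := rcdf_ge0 N (v - t%:R); have := rcdf_le1 N v; lra.
have [Fv0|] := leP (F (v - t%:R)) 0; last exact: window_le_half_pos.
(* Here [v] is moved right to a point where the lower edge of the window has
   an arbitrarily small positive mass to its left. *)
have [cF _ _ _ _] := N_CND.
apply/ler_addgt0Pr => e e0.
(* The first bound makes the loss at the lower edge at most [e]; the second puts [q] below
   [F (- h)], so that the moved window still ends at or before [h]. *)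
pose q := Num.min (e / 2) ((1 - F h) / 2).
have q0 : 0 < q by rewrite lt_min; apply/andP; split; lra.
have [qe qh] : q <= e /\ q < 1 - F h.
  rewrite /q; split; first by rewrite ge_min; apply/orP; left; lra.
  by rewrite gt_min; apply/orP; right; lra.
have [u Fu] : exists u, F u = q.
  by apply: rcdf_attains => //; rewrite q0/=; have := rcdf_ge0 N h; lra.
have vu : v - t%:R <= u.
  by apply/ltW/(rcdf_lt_inv (X := N)); rewrite Fu; lra.
have uh : u + t%:R <= h.
  suff : u <= - h by lra.
  by apply/ltW/(rcdf_lt_inv (X := N)); rewrite Fu CND_rcdfN; lra.
have := @window_le_half_pos (u + t%:R) Fh1 uh.
rewrite addrK Fu => /(_ q0).
have : F v <= F (u + t%:R) by apply: rcdf_nondecreasing; lra.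
by have := rcdf_ge0 N (v - t%:R); lra.
Qed.

End cnd_window.

Theorem corollary11 (R : realType) (f : R -> R)
  (f_tradeoff : is_tradeoff f)
  (f_sym : symmetric_tradeoff f)
  (f_nontriv : nontrivial_tradeoff f)
  (d : measure_display) (T : measurableType d) (P : probability T R)
  (N : {RV P >-> R}) (N_CND : is_CND f N)
  (d' : measure_display) (T' : measurableType d') (P' : probability T' R)
  (N' : {RV P' >-> R})
  (N'_f : forall alpha : R, alpha \in `[0, 1] ->
     f alpha <= tradeoffRV N' (shiftRV N' 1) alpha)
  (t : nat) :
  (P [set w | (`|N w| <= t%:R / 2)%R] >=
   ereal_sup [set P' [set w | (- (t%:R / 2) < N' w - a <= t%:R / 2)%R]
             | a in [set: R]])%E.
Proof.
have t0 : 0 <= t%:R / 2 :> R by rewrite divr_ge0.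
apply: ge_ereal_sup => _ [a _ <-].
have -> : [set w | (- (t%:R / 2) < N' w - a <= t%:R / 2)%R] =
    [set w | (a + t%:R / 2 - t%:R < N' w <= a + t%:R / 2)%R].
  by apply/seteqP; split => w /= /andP[? ?]; apply/andP; split; lra.
rewrite probability_itv_rcdf; last by lra.
have -> : [set w | (`|N w| <= t%:R / 2)%R] = N @^-1` `[- (t%:R / 2), t%:R / 2].
  by apply/seteqP; split => w /=; rewrite ler_norml in_itv.
(* Dropping the left endpoint of the closed window can only lower its mass. *)
apply: (@le_trans _ _ (P [set w | (t%:R / 2 - t%:R < N w <= t%:R / 2)%R])).
  rewrite probability_itv_rcdf; last by lra.
  rewrite lee_fin; set z := a + _.
  have M0 := window_le_half f_tradeoff N_CND t (t%:R / 2).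
  have [cF _ _ _ _] := N_CND.
  (* With no mass up to [z], the window of [N'] is null; otherwise a positive level [q] can be
     matched. *)
  have [G0|G0] := leP (rcdf N' z) 0.
    have := rcdf_ge0 N' (z - t%:R).
    suff : rcdf N (t%:R / 2 - t%:R) <= rcdf N (t%:R / 2) by lra.
    by apply: rcdf_nondecreasing; lra.
  (* [rcdf N' z] may equal [1], a level that [rcdf N] need not attain. *)
  apply/ler_addgt0Pr => e e0.
  pose q := Num.max (rcdf N' z - e) (rcdf N' z / 2).
  have [qe qh] : rcdf N' z <= q + e /\ 0 < q < rcdf N' z.
    split; first by rewrite -lerBlDr le_max lexx.
    rewrite lt_max gt_max; apply/andP; split; last by apply/andP; split; lra.
    by apply/orP; right; lra.
  have G1 := rcdf_le1 N' z.
  have [y Fy] : exists y, rcdf N y = q by apply: rcdf_attains => //; lra.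
  have Fy1 : rcdf N y < 1 by rewrite Fy; lra.
  (* The upper end of the window of [N'] exceeds [q] by at most [e] and its lower end is at least
     [rcdf N (y - t%:R)], so its mass is at most [e] plus that of the window of [N] ending at
     [y]. *)
  have := CND_rcdf_shift_le f_tradeoff N_CND N'_f t Fy1 (z := z).
  have := window_le_half f_tradeoff N_CND t y.
  have : rcdf N y <= rcdf N' z by rewrite Fy; lra.
  by rewrite Fy => qz + /(_ qz); lra.
apply: le_measure; rewrite ?inE.
- rewrite (_ : [set w | _] = N @^-1` `]t%:R / 2 - t%:R, t%:R / 2]).
    exact: measurable_funPTI.
  by apply/seteqP; split => w /=; rewrite in_itv.
- exact: measurable_funPTI.
- by move=> w /= /andP[? ?]; rewrite in_itv/=; apply/andP; split; lra.
Qed.
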